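(* Let $N \geq 4$ be an even integer and let $\mathbb{U}=\{1,\dots,N\}$. Let $C=(C_{i,j})_{1\le i<j\le N}$ be real numbers (compatibilities, with $C_{j,i}:=C_{i,j}$), unknown to an observer. An observation consists of choosing a pairing $S$ of $\mathbb{U}$ and learning the value $C_{\mathrm{sum}}(S)=\sum_{\{i,j\}\in S} C_{i,j}$. Define $\tilde{C}_{i,j}$ for $1\le i<j\le N$ by $$\tilde{C}_{i,j}=\begin{cases}0, & \text{if } i=1 \text{ or } j=1,\\ C_{i,j}-C_{1,i}-C_{1,j}+\frac{2}{N-2}\sum_{k=2}^{N}C_{1,k}, & \text{otherwise.}\end{cases}$$ Then the minimum number of observations required to know the entire set of values $\tilde{C}=(\tilde C_{i,j})$ (i.e., the minimum number of pairings whose total compatibilities determine all $\tilde{C}_{i,j}$ uniquely, for every choice of $C$) is $(N-1)(N-2)/2$.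
   Context: A pairing of $\mathbb{U}=\{1,\dots,N\}$ ($N$ even) is a set $S$ of two-element subsets $\{i,j\}\subseteq \mathbb{U}$ ($i\ne j$) that are pairwise disjoint and whose union is $\mathbb{U}$; i.e., a partition of $\mathbb{U}$ into $N/2$ pairs (a perfect matching of the complete graph on $\mathbb{U}$). The individual compatibilities $C_{i,j}$ cannot be observed directly; only totals $C_{\mathrm{sum}}(S)$ for chosen pairings $S$ are observed. *)

(* Defs.v *)
From mathcomp Require Import all_boot all_order all_algebra.
From mathcomp Require Import reals.

Set Implicit Arguments.
Unset Strict Implicit.
Unset Printing Implicit Defensive.

Import Order.TTheory GRing.Theory Num.Theory.
Local Open Scope ring_scope.

(* The universe {1, ..., N} is 'I_N with indices shifted down by one, so the
   distinguished element 1 is the ordinal of value 0. *)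
Definition elt1 (N : nat) (hN : (4 <= N)%N) : 'I_N :=
  Ordinal (ltn_trans (isT : (0 < 3)%N) hN).

Definition pairing (N : nat) (S : {set {set 'I_N}}) : bool :=
  partition S [set: 'I_N] && [forall e in S, #|e| == 2].

(* A family (C_{i,j})_{i<j} extended by C_{j,i} := C_{i,j} is a symmetric
   matrix; its diagonal is never read. *)
Definition compatibility (R : realType) (N : nat) (C : 'M[R]_N) : Prop :=
  C^T = C.

Definition Csum (R : realType) (N : nat) (C : 'M[R]_N)
    (S : {set {set 'I_N}}) : R :=
  \sum_(i < N) \sum_(j < N | (i < j)%N && ([set i; j] \in S)) C i j.

Definition tildeC (R : realType) (N : nat) (hN : (4 <= N)%N) (C : 'M[R]_N)
    (i j : 'I_N) : R :=
  let o := elt1 hN in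
  if (i == o) || (j == o) then 0
  else C i j - C o i - C o j
       + 2 / (N%:R - 2) * \sum_(k < N | k != o) C o k.

(* "The totals over T determine all tildeC": T is fixed independently of the
   unknown C, and no two compatibilities with the same totals over T have
   different tildeC. *)
Definition determines_tildeC (R : realType) (N : nat) (hN : (4 <= N)%N)
    (T : {set {set {set 'I_N}}}) : Prop :=
  forall C C' : 'M[R]_N, compatibility C -> compatibility C' ->
    (forall S, S \in T -> Csum C S = Csum C' S) ->
    forall i j : 'I_N, (i < j)%N -> tildeC hN C i j = tildeC hN C' i j.

Definition sufficient_observations (R : realType) (N : nat) (hN : (4 <= N)%N)
    (T : {set {set {set 'I_N}}}) : Prop :=
  (forall S, S \in T -> pairing S) /\ determines_tildeC R hN T.

(* Main.v *)
(* Every total Csum C S equals Csum (tildeC C) S, and tildeC is the projection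
   onto the space W of symmetric matrices vanishing on the row of the
   distinguished element o, of dimension d = (N-1)(N-2)/2. So a set T of
   pairings determines tildeC iff its totals are jointly injective on W, i.e.
   iff the matrix of these totals has full column rank d; hence #|T| >= d, and d
   suitable pairings suffice if all pairings together are injective on W.
   For the latter, let D in W have all totals 0. Two pairings that differ only
   by {o,b},{c,d} versus {o,c},{b,d} give D c d = D b d, so D is constant off
   the row of o, and one more total shows that the constant is 0. *)
Require Import Defs.
From mathcomp Require Import all_boot all_order all_algebra.
From mathcomp Require Import perm.
From mathcomp Require Import ring lra zify.
From mathcomp Require Import reals.

Set Implicit Arguments.
Unset Strict Implicit.
Unset Printing Implicit Defensive.

Import Order.TTheory GRing.Theory Num.Theory.
Local Open Scope ring_scope.

(** * Pairings as fixed-point-free involutions, and their totals *)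

Definition fpf_involution (N : nat) (f : 'I_N -> 'I_N) : Prop :=
  involutive f /\ forall i, f i != i.

Definition mate_of (N : nat) (S : {set {set 'I_N}}) (f : 'I_N -> 'I_N) : Prop :=
  forall i j, i != j -> ([set i; j] \in S) = (j == f i).

Lemma set2_injr (T : finType) (i j k : T) :
  i != j -> [set i; j] = [set i; k] -> j = k.
Proof.
move=> ij E; have: j \in [set i; k] by rewrite -E set22.
by rewrite !inE eq_sym (negbTE ij) /= => /eqP.
Qed.

Lemma pairing_mate (N : nat) (S : {set {set 'I_N}}) :
  pairing S -> exists2 f, fpf_involution f & mate_of S f.
Proof.
move=> /andP[/and3P[/eqP covS trivS _] /forall_inP S2].
have ex i : exists j, (j != i) && ([set i; j] \in S).
  have iS : i \in cover S by rewrite covS inE.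
  have /cards2P[x [y [xy E]]] := S2 _ (pblock_mem iS).
  have: i \in pblock S i by rewrite mem_pblock.
  rewrite E !inE => /orP[]/eqP iE.
    by exists y; rewrite iE eq_sym xy -E pblock_mem.
  by exists x; rewrite iE xy setUC -E pblock_mem.
pose f i := xchoose (ex i).
have fi i : f i != i by have /andP[] := xchooseP (ex i).
have fS i : [set i; f i] \in S by have /andP[] := xchooseP (ex i).
(* Blocks through [i] coincide by disjointness, so the chosen mate is the only one. *)
have mf : mate_of S f.
  move=> i j ij; apply/idP/eqP => [ijS|->//].
  apply: (set2_injr ij).
  rewrite -(def_pblock trivS ijS (set21 i j)).
  by rewrite -(def_pblock trivS (fS i) (set21 i (f i))).
exists f => //; split=> // i.
by apply/esym/eqP; rewrite -mf // setUC.
Qed.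

Lemma mate_pairing (N : nat) (f : 'I_N -> 'I_N) :
  fpf_involution f -> exists2 S, pairing S & mate_of S f.
Proof.
move=> [ff fi]; exists [set [set i; f i] | i : 'I_N].
  have E i x : x \in [set i; f i] -> [set i; f i] = [set x; f x].
    by rewrite !inE => /orP[]/eqP-> //; rewrite ff setUC.
  apply/andP; split; last first.
    apply/forall_inP => _ /imsetP[i _ ->].
    by rewrite cards2 (eq_sym i) fi.
  apply/and3P; split.
  - rewrite eqEsubset subsetT; apply/subsetP => i _.
    apply/bigcupP; exists [set i; f i]; last exact: set21.
    by apply/imsetP; exists i.
  - apply/trivIsetP => _ _ /imsetP[i _ ->] /imsetP[j _ ->].
    apply: contraNT => /pred0Pn[x /andP[/= xi xj]].
    by rewrite (E _ _ xi) (E _ _ xj).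
  - by apply/negP => /imsetP[i _ /setP/(_ i)]; rewrite !inE eqxx.
move=> i j ij; apply/imsetP/eqP => [[k _ E]|->]; last by exists i.
have: i \in [set k; f k] by rewrite -E set21.
rewrite !inE => /orP[]/eqP ik; subst i; first exact: set2_injr E.
by apply: (set2_injr ij); rewrite ff E setUC.
Qed.

(** Summing over all [i] meets each pair once from either end, hence the factor 2; the condition
    [i < j] disappears and sums can be reindexed along [f]. *)
Lemma Csum_mate (R : realType) (N : nat) (C : 'M[R]_N)
    (S : {set {set 'I_N}}) (f : 'I_N -> 'I_N) :
  compatibility C -> fpf_involution f -> mate_of S f ->
  Csum C S *+ 2 = \sum_i C i (f i).
Proof.
move=> Csym [_ fi] mf.
transitivity (\sum_i \sum_(j | (i != j) && ([set i; j] \in S)) C i j);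
  last first.
  apply: eq_bigr => i _; rewrite (big_pred1 (f i)) // => j /=.
  have [<-|ij] := eqVneq i j; last by rewrite mf.
  by rewrite /= eq_sym (negbTE (fi i)).
have -> : Csum C S *+ 2 = Csum C S +
    \sum_(i < N) \sum_(j < N | (j < i)%N && ([set i; j] \in S)) C i j.
  rewrite mulr2n; congr (_ + _); rewrite /Csum (exchange_big_dep xpredT) //=.
  apply: eq_bigr => j _; apply: eq_big => [i|i _].
    by rewrite setUC.
  by rewrite -[in LHS]Csym mxE.
rewrite /Csum -big_split; apply: eq_bigr => i _ /=.
rewrite [RHS](bigID (fun j : 'I_N => (i < j)%N)) /=.
by congr (_ + _); apply: eq_bigl => j; rewrite -val_eqE /=;
   case: (_ \in S); lia.
Qed.

Lemma eq_Csum (R : realType) (N : nat) (A B : 'M[R]_N) S :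
  (forall i j : 'I_N, (i < j)%N -> A i j = B i j) -> Csum A S = Csum B S.
Proof.
by move=> E; apply: eq_bigr => i _; apply: eq_bigr => j /andP[/E].
Qed.

Lemma CsumB (R : realType) (N : nat) (A B : 'M[R]_N) S :
  Csum (A - B) S = Csum A S - Csum B S.
Proof.
rewrite /Csum -sumrB; apply: eq_bigr => i _.
by rewrite -sumrB; apply: eq_bigr => j _; rewrite !mxE.
Qed.

Lemma Csum_lincomb (R : realType) (N d : nat) (v : 'cV[R]_d)
    (B : 'I_d -> 'M[R]_N) S :
  Csum (\sum_k v k 0 *: B k) S = \sum_k v k 0 * Csum (B k) S.
Proof.
under [RHS]eq_bigr do rewrite mulr_sumr.
rewrite exchange_big; apply: eq_bigr => i _ /=.
under [RHS]eq_bigr do rewrite mulr_sumr.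
rewrite exchange_big; apply: eq_bigr => j _ /=.
by rewrite summxE; apply: eq_bigr => k _; rewrite mxE.
Qed.

(** * The projection onto W and its totals *)

Definition tilde_mx (R : realType) (N : nat) (hN : (4 <= N)%N) (C : 'M[R]_N) :
  'M[R]_N := \matrix_(i, j) tildeC hN C i j.

Lemma tilde_mx_sym (R : realType) (N : nat) (hN : (4 <= N)%N) (C : 'M[R]_N) :
  compatibility C -> compatibility (tilde_mx hN C).
Proof.
move=> Csym; apply/matrixP => i j; rewrite !mxE /tildeC orbC.
case: ifP => // _; have -> : C j i = C i j by rewrite -{1}Csym mxE.
by congr (_ + _); rewrite addrAC.
Qed.

(* Off the diagonal tildeC i j = C i j - a i - a j with a of total 0, and
   a pairing uses every a i exactly once. *)
Lemma Csum_tilde (R : realType) (N : nat) (hN : (4 <= N)%N) (C : 'M[R]_N) S :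
  compatibility C -> pairing S -> Csum (tilde_mx hN C) S = Csum C S.
Proof.
move=> Csym /pairing_mate[f fP mf]; have [ff fi] := fP.
apply: (@pmulrnI _ 2) => //.
rewrite !(Csum_mate _ fP mf) //; last exact: tilde_mx_sym.
set o := elt1 hN; set s := \sum_(k < N | k != o) C o k.
have N2 : N%:R - 2 != 0 :> R.
  by rewrite -natrB ?(leq_trans _ hN) // pnatr_eq0; lia.
(* Vanishing on the row of [o] forces [a o + a j = C o j]; the value at [o] is then the one for
   which the [a i] sum to 0: [s/(N-2) + s - (N-1)s/(N-2) = 0]. *)
pose a i := if i == o then s / (N%:R - 2) else C o i - s / (N%:R - 2).
have tE i : tilde_mx hN C i (f i) = C i (f i) - a i - a (f i).
  rewrite mxE /tildeC /a -/o -/s.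
  have [->|io] := eqVneq i o.
    by rewrite (negbTE (fi o)) /=; ring.
  have [E|fo] := eqVneq (f i) o.
    have -> : C i (f i) = C o i by rewrite E -[in LHS]Csym mxE.
    by rewrite /=; ring.
  by rewrite /=; field.
rewrite (eq_bigr _ (fun i _ => tE i)) !sumrB.
have suma : \sum_i a i = 0.
  rewrite (bigD1 o) //= {1}/a eqxx.
  rewrite (eq_bigr (fun i => C o i - s / (N%:R - 2))); last first.
    by move=> i /negbTE io; rewrite /a io.
  rewrite sumrB -/s sumr_const cardC1 card_ord -[_ *+ N.-1]mulr_natr.
  have -> : N.-1%:R = N%:R - 1 :> R by rewrite -subn1 natrB //; lia.
  by field.
have <- : \sum_i a i = \sum_i a (f i).
  by rewrite (reindex_inj (inv_inj ff)).
by rewrite suma !subr0.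
Qed.

Lemma tilde_mx_id (R : realType) (N : nat) (hN : (4 <= N)%N) (C : 'M[R]_N) :
  compatibility C -> (forall k, C (elt1 hN) k = 0) -> tilde_mx hN C = C.
Proof.
move=> Csym C0; apply/matrixP => i j; rewrite mxE /tildeC.
have [->|io] := eqVneq i; first by rewrite C0.
have [->|jo] := eqVneq j; first by rewrite -Csym mxE C0.
by rewrite /= !C0 big1 ?mulr0 ?subr0 ?addr0.
Qed.

Lemma tilde_mx_row0 (R : realType) (N : nat) (hN : (4 <= N)%N) (C : 'M[R]_N) k :
  tilde_mx hN C (elt1 hN) k = 0.
Proof. by rewrite mxE /tildeC eqxx. Qed.

(** * Injectivity of the totals on W *)

Lemma fpf_involution_rev (N : nat) :
  ~~ odd N -> fpf_involution (@rev_ord N).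
Proof.
move=> Nev; split=> [|i]; first exact: rev_ordK.
(* A fixed point would give [2i + 1 = N], against the parity of [N]. *)
by rewrite -val_eqE /=; apply/eqP; have := ltn_ord i; lia.
Qed.

Lemma fpf_involution_conj (N : nat) (f : 'I_N -> 'I_N) (x y : 'I_N) :
  fpf_involution f -> fpf_involution (tperm x y \o f \o tperm x y).
Proof.
move=> [ff fi]; split=> i /=; first by rewrite !tpermK ff tpermK.
by apply: contra (fi (tperm x y i)) => /eqP {2}<-; rewrite tpermK.
Qed.

Lemma fpf_involution_through (N : nat) (o b c d : 'I_N) :
  ~~ odd N -> uniq [:: o; b; c; d] ->
  exists2 f : 'I_N -> 'I_N, fpf_involution f & f o = b /\ f c = d.
Proof.
move=> Nev; rewrite /= !inE !negb_or -!andbA.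
move=> /and5P[ob oc od bc /and3P[bd cd _]].
have f0P := fpf_involution_rev Nev.
(* Relabelling the mate of [o] as [b] makes [b] the mate of [o]. *)
have f1P := fpf_involution_conj (rev_ord o) b f0P.
set f1 := (_ \o _ \o _) in f1P.
have f1o : f1 o = b.
  by rewrite /f1 /= (@tpermD _ _ _ o) ?tpermL // 1?eq_sym //;
     rewrite eq_sym; case: f0P.
clearbody f1; have [f1K f1i] := f1P.
(* The same device for [c] and [d]; neither [f1 c] nor [d] is [o] or [b], so the pair of [o] and [b]
   survives. *)
exists (tperm (f1 c) d \o f1 \o tperm (f1 c) d).
  exact: fpf_involution_conj.
have f1cb : f1 c != b by rewrite -f1o (inj_eq (inv_inj f1K)) eq_sym.
have f1co : f1 c != o.
  by apply: contra bc => /eqP E; rewrite -f1o -E f1K.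
split=> /=.
  by rewrite (@tpermD _ _ _ o) ?(eq_sym d) // f1o tpermD ?(eq_sym d).
by rewrite (@tpermD _ _ _ c) ?(eq_sym d) // tpermL.
Qed.

(** Conjugating an involution through both pairs by the transposition of [b] and [c] re-pairs these
    four elements and leaves every other pair alone, so equal totals leave only four terms to
    compare. *)
Lemma Csum_swap (R : realType) (N : nat) (D : 'M[R]_N) (o b c d : 'I_N) :
  ~~ odd N -> compatibility D -> (forall S, pairing S -> Csum D S = 0) ->
  uniq [:: o; b; c; d] -> D o b + D c d = D o c + D b d.
Proof.
move=> Nev Dsym D0 un.
have D0f f : fpf_involution f -> \sum_i D i (f i) = 0.
  by move=> fP; have [S /D0 S0 mf] := mate_pairing fP;
     rewrite -(Csum_mate Dsym fP mf) S0 mul0rn.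
have [f fP [fo fc]] := fpf_involution_through Nev un.
have [ff fi] := fP.
have fb : f b = o by rewrite -fo ff.
have fd : f d = c by rewrite -fc ff.
have gP := fpf_involution_conj b c fP.
set g := (_ \o _ \o _) in gP.
move: un; rewrite /= !inE !negb_or -!andbA.
move=> /and5P[ob oc od bc /and3P[bd cd _]].
have go : g o = c by rewrite /g /= (@tpermD _ _ _ o) ?(eq_sym _ o) // fo tpermL.
have gb : g b = d by rewrite /g /= tpermL fc tpermD.
have gc : g c = o by rewrite /g /= tpermR fb tpermD ?(eq_sym _ o).
have gd : g d = b by rewrite /g /= (@tpermD _ _ _ d) // fd tpermR.
have gf i : i \notin [:: o; b; c; d] -> g i = f i.
  rewrite !inE !negb_or => /and4P[io ib ic id].
  rewrite /g /= (@tpermD _ _ _ i) 1?eq_sym // tpermD // eq_sym.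
    by rewrite -fo (inj_eq (inv_inj ff)).
  by rewrite -fd (inj_eq (inv_inj ff)).
clearbody g.
have split4 (F : 'I_N -> R) : \sum_i F i =
  F o + (F b + (F c + (F d + \sum_(i | i \notin [:: o; b; c; d]) F i))).
  rewrite (bigD1 o) // (bigD1 b) 1?eq_sym // (bigD1 c) /=; last first.
    by rewrite !(eq_sym c) oc.
  rewrite (bigD1 d) /=; last by rewrite !(eq_sym d) od bd.
  do 4! congr (_ + _); apply: eq_bigl => i.
  by rewrite !inE !negb_or -!andbA.
have : \sum_i D i (g i) = \sum_i D i (f i) by rewrite !D0f.
rewrite !split4 go gb gc gd fo fb fc fd.
rewrite (eq_bigr (fun i => D i (f i))) => [|i /gf -> //].
have sym x y : D x y = D y x by rewrite -[in LHS]Dsym mxE.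
rewrite (sym c o) (sym d b) (sym b o) (sym d c).
by lra.
Qed.

Lemma Csum_inj (R : realType) (N : nat) (hN : (4 <= N)%N) (D : 'M[R]_N) :
  ~~ odd N -> compatibility D -> (forall k, D (elt1 hN) k = 0) ->
  (forall S, pairing S -> Csum D S = 0) ->
  forall i j, i != j -> D i j = 0.
Proof.
move=> Nev Dsym; set o := elt1 hN => Do D0 c d cd.
have sym x y : D x y = D y x by rewrite -[in LHS]Dsym mxE.
have [->//|co] := eqVneq c o.
have [->|do_] := eqVneq d o; first by rewrite sym.
have sw x y z : x != o -> y != o -> z != o -> x != z -> y != z ->
    D x z = D y z.
  move=> xo yo zo xz yz; have [->//|xy] := eqVneq x y.
  have := @Csum_swap _ _ D o y x z Nev Dsym D0.
  rewrite !Do !add0r; apply.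
  by rewrite /= !inE !negb_or !(eq_sym o) xo yo zo (eq_sym y x) xy xz yz.
(* For [y] other than [d], the chain is [D x y = D d y = D y d = D c d]. *)
have const x y : x != o -> y != o -> x != y -> D x y = D c d.
  move=> xo yo xy; have [yd|yd] := eqVneq y d.
    by rewrite yd; apply: sw => //; rewrite -yd.
  rewrite (sw x d y) //; last by rewrite eq_sym.
  by rewrite sym; apply: sw.
have fP := fpf_involution_rev Nev; have [ff fi] := fP.
set f := @rev_ord N in fP ff fi.
have [S /D0 S0 mf] := mate_pairing fP.
have := Csum_mate Dsym fP mf; rewrite S0 mul0rn.
(* The pair containing [o] contributes 0; the other [N - 2] terms all equal [D c d], and [N - 2] is
   nonzero. *)
rewrite (bigD1 o) //= Do (bigD1 (f o)) //= ff sym Do !add0r.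
rewrite (eq_bigr (fun=> D c d)); last first.
  move=> i /andP[io ifo]; apply: const => //; last by rewrite eq_sym.
  by apply: contra ifo => /eqP <-; rewrite ff.
rewrite sumr_const => /esym/eqP; rewrite mulrn_eq0 => /orP[|/eqP//].
have -> : #|[pred i | (i != o) && (i != f o)]| = #|~: [set o; f o]|.
  by apply: eq_card => i; rewrite !inE negb_or.
have := cardsC [set o; f o]; rewrite cards2 card_ord eq_sym fi /=.
by lia.
Qed.

(** * Coordinates on W *)

(* 0 < p.1 says that the pair avoids the distinguished element. *)
Definition free_pairs (N : nat) : {set 'I_N * 'I_N} :=
  [set p : 'I_N * 'I_N | (0 < p.1)%N && (p.1 < p.2)%N].

(** Counted by the larger index [j]: the smaller one ranges over 1 to [j - 1], and these counts add
    up to the binomial coefficient of [N - 1] over 2. *)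
Lemma card_free_pairs (N : nat) :
  #|free_pairs N| = (((N - 1) * (N - 2)) %/ 2)%N.
Proof.
rewrite -sum1dep_card -(pair_big_dep xpredT
  (fun i j : 'I_N => (0 < i)%N && (i < j)%N) (fun _ _ => 1%N)) /=.
rewrite (exchange_big_dep xpredT) //=.
(* The truncated predecessor gives the right count 0 at [j = 0] too. *)
rewrite (eq_bigr (fun j : 'I_N => j.-1)).
  case: N => [|n]; first by rewrite big_ord0.
  rewrite big_ord_recl /= add0n.
  rewrite (eq_bigr (fun i : 'I_n => i : nat)) //.
  rewrite -(big_mkord xpredT id) bin2_sum bin2.
  by rewrite -divn2 !subSS subn0 subn1.
move=> j _; rewrite sum1dep_card.
rewrite -[RHS]card_ord.
have jN (i : 'I_j.-1) : (i.+1 < N)%N.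
  by have := ltn_ord i; have := ltn_ord j; lia.
pose h (i : 'I_j.-1) : 'I_N := Ordinal (jN i).
have hI : injective h by move=> x y [] /val_inj.
rewrite -(card_codom hI); apply: eq_card => i; rewrite inE.
apply/andP/codomP => [[i0 ij]|[k ->]].
  have ij' : (i.-1 < j.-1)%N by lia.
  by exists (Ordinal ij'); apply: val_inj => /=; lia.
by split=> //=; have := ltn_ord k; lia.
Qed.

(** The symmetrised matrix units, a basis of W up to the diagonal, which no total reads. *)
Definition pair_mx (R : realType) (N : nat) (k : 'I_#|free_pairs N|) : 'M[R]_N :=
  \matrix_(i, j) ((enum_val k == (i, j)) || (enum_val k == (j, i)))%:R.

Definition comb_mx (R : realType) (N : nat) (v : 'cV[R]_#|free_pairs N|) :
  'M[R]_N := \sum_k v k 0 *: pair_mx R k.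

Lemma comb_mx_sym (R : realType) (N : nat) (v : 'cV[R]_#|free_pairs N|) :
  compatibility (comb_mx v).
Proof.
apply/matrixP => i j; rewrite mxE !summxE; apply: eq_bigr => k _.
by rewrite !mxE orbC.
Qed.

Lemma free_pairP (N : nat) (k : 'I_#|free_pairs N|) :
  (0 < (enum_val k).1)%N && ((enum_val k).1 < (enum_val k).2)%N.
Proof. by have := enum_valP k; rewrite inE. Qed.

Lemma comb_mx_row0 (R : realType) (N : nat) (hN : (4 <= N)%N)
    (v : 'cV[R]_#|free_pairs N|) j : comb_mx v (elt1 hN) j = 0.
Proof.
rewrite summxE big1 // => k _; rewrite !mxE.
have := free_pairP k; case: (enum_val k) => a b /= /andP[a0 ab].
rewrite !xpair_eqE -!val_eqE /= (gtn_eqF a0) (gtn_eqF (ltn_trans a0 ab)).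
by rewrite andbF mulr0.
Qed.

Lemma comb_mx_val (R : realType) (N : nat) (v : 'cV[R]_#|free_pairs N|) k :
  comb_mx v (enum_val k).1 (enum_val k).2 = v k 0.
Proof.
rewrite summxE (bigD1 k) //= big1 => [|l lk]; rewrite !mxE.
  by rewrite -surjective_pairing eqxx mulr1 addr0.
rewrite -surjective_pairing (inj_eq enum_val_inj) (negbTE lk) /=.
have := free_pairP k; have := free_pairP l.
case: (enum_val l) (enum_val k) => a b [c d] /= /andP[_ ab] /andP[_ cd].
(* A free pair is increasing, so it is never the reversal of another. *)
case: eqP => [[ad bc]|_]; last by rewrite mulr0.
by move: ab cd; rewrite ad bc; lia.
Qed.

Lemma comb_mx_coord (R : realType) (N : nat) (hN : (4 <= N)%N) (D : 'M[R]_N)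
    (i j : 'I_N) :
  (forall k, D (elt1 hN) k = 0) -> (i < j)%N ->
  comb_mx (\col_k D (enum_val k).1 (enum_val k).2) i j = D i j.
Proof.
move=> D0 ij; have [i0|i0] := posnP i.
  have -> : i = elt1 hN by apply: val_inj.
  by rewrite comb_mx_row0 D0.
have ijF : (i, j) \in free_pairs N by rewrite inE i0 ij.
have := comb_mx_val (\col_k D (enum_val k).1 (enum_val k).2)
  (enum_rank_in ijF (i, j)).
by rewrite mxE enum_rankK_in.
Qed.

(** * Observation matrices: a row per pairing, a column per free pair *)

Definition obs_mx (R : realType) (N m : nat) (S : 'I_m -> {set {set 'I_N}}) :
  'M[R]_(m, #|free_pairs N|) := \matrix_(s, k) Csum (pair_mx R k) (S s).

Lemma obs_mxE (R : realType) (N m : nat) (S : 'I_m -> {set {set 'I_N}})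
    (v : 'cV[R]_#|free_pairs N|) s :
  (obs_mx R S *m v) s 0 = Csum (comb_mx v) (S s).
Proof.
by rewrite Csum_lincomb mxE; apply: eq_bigr => k _; rewrite mxE mulrC.
Qed.

(** The columns of [cokermx A] lie in the kernel of [A], so a trivial kernel makes [cokermx A] zero;
    its rank is [n - \rank A]. *)
Lemma row_full_ker (F : fieldType) (m n : nat) (A : 'M[F]_(m, n)) :
  (forall v : 'cV_n, A *m v = 0 -> v = 0) <-> row_full A.
Proof.
split=> [inj|/row_fullP[B BA] v Av]; last by rewrite -[v]mul1mx -BA -mulmxA Av mulmx0.
have : \rank (cokermx A) = 0%N.
  apply/eqP; rewrite mxrank_eq0; apply/eqP/matrixP => i j.
  have /inj/matrixP/(_ i 0) : A *m col j (cokermx A) = 0.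
    by rewrite colE mulmxA mulmx_coker mul0mx.
  by rewrite !mxE.
rewrite mxrank_coker => /eqP; rewrite subn_eq0 => le.
by rewrite /row_full eqn_leq rank_leq_col.
Qed.

(** Pairings come as an indexed family so that they label matrix rows. Forward, a kernel vector
    gives an element of W indistinguishable from 0; backward, the difference of two projections lies
    in W and has zero totals over [T]. *)
Lemma determinesP (R : realType) (N m : nat) (hN : (4 <= N)%N)
    (S : 'I_m -> {set {set 'I_N}}) (T : {set {set {set 'I_N}}}) :
  (forall s, pairing (S s)) -> (forall X, (X \in T) = (X \in codom S)) ->
  determines_tildeC R hN T <-> row_full (obs_mx R S).
Proof.
move=> Sp TS; rewrite -row_full_ker; split=> [det v Mv|inj C C' Csym C'sym CC' i j ij].
  apply/colP => k; rewrite -comb_mx_val.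
  have k12 : ((enum_val k).1 < (enum_val k).2)%N by have /andP[] := free_pairP k.
  have z0 : compatibility (0 : 'M[R]_N) by rewrite /compatibility trmx0.
  have := det (comb_mx v) 0 (comb_mx_sym v) z0 _ _ _ k12.
  have tE D : tildeC hN D (enum_val k).1 (enum_val k).2 =
     tilde_mx hN D (enum_val k).1 (enum_val k).2 by rewrite mxE.
  rewrite !tE !tilde_mx_id //; first last.
  - exact: comb_mx_row0.
  - exact: comb_mx_sym.
  - by move=> ?; rewrite mxE.
  rewrite !mxE; apply=> X; rewrite TS => /codomP[s ->].
  rewrite -obs_mxE Mv mxE -[0 : 'M_N](subrr 0) CsumB subrr //.
pose D := tilde_mx hN C - tilde_mx hN C'.
have D0 k : D (elt1 hN) k = 0 by rewrite mxE tilde_mx_row0 mxE tilde_mx_row0 subrr.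
have /inj/colP v0 : obs_mx R S *m (\col_k D (enum_val k).1 (enum_val k).2) = 0.
  apply/colP => s; rewrite obs_mxE mxE.
  rewrite (@eq_Csum _ _ _ D) => [|x y xy]; last exact: (comb_mx_coord D0).
  by rewrite CsumB !Csum_tilde // CC' ?subrr // TS codom_f.
have : D i j = 0.
  rewrite -(comb_mx_coord D0 ij) summxE big1 // => k _.
  by rewrite mxE v0 mxE mul0r.
by rewrite !mxE => /eqP; rewrite subr_eq0 => /eqP.
Qed.

(** * The two bounds *)

Theorem theorem1 (R : realType) (N : nat) (hN : (4 <= N)%N)
    (N_even : ~~ odd N) :
  (exists T : {set {set {set 'I_N}}},
      sufficient_observations R hN T
      /\ #|T| = (((N - 1) * (N - 2)) %/ 2)%N)
  /\ (forall T : {set {set {set 'I_N}}},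
      sufficient_observations R hN T ->
      (((N - 1) * (N - 2)) %/ 2 <= #|T|)%N).
Proof.
rewrite -card_free_pairs; split; last first.
  move=> T [Tp det].
  have Sp (s : 'I_#|T|) : pairing (enum_val s) by apply/Tp/enum_valP.
  have TS X : (X \in T) = (X \in codom (@enum_val _ (mem T))).
    apply/idP/codomP => [XT|[s ->]]; last exact: enum_valP.
    by exists (enum_rank_in XT X); rewrite enum_rankK_in.
  (* Full column rank: the number of free pairs is the rank, at most the number of rows [#|T|]. *)
  have /eqP <- := (determinesP R hN Sp TS).1 det.
  exact: rank_leq_row.
pose P := [set S : {set {set 'I_N}} | pairing S].
pose S (s : 'I_#|P|) : {set {set 'I_N}} := enum_val s.
have Sp s : pairing (S s) by have := enum_valP s; rewrite inE.
have full : row_full (obs_mx R S).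
  apply/row_full_ker => v Mv; apply/colP => k; rewrite -comb_mx_val mxE.
  have /andP[_ k12] := free_pairP k.
  apply: (Csum_inj N_even (comb_mx_sym v) (comb_mx_row0 hN v)).
    move=> X Xp; have XP : X \in P by rewrite inE.
    rewrite -(enum_rankK_in XP XP) -/(S _) -obs_mxE Mv mxE //.
  by rewrite -val_eqE ltn_eqF.
(* [g] selects as many independent rows of the matrix of all pairings as it has columns. *)
pose g := fullrankfun full.
pose T := [set S (g k) | k : 'I_#|free_pairs N|].
(* Distinct selected rows come from distinct pairings, so [T] has exactly the required size. *)
have SgI : injective (S \o g).
  by apply: inj_comp; [exact: enum_val_inj|exact: fullrankfun_inj].
exists T; split; last by rewrite card_imset // card_ord.
split; first by move=> _ /imsetP[k _ ->].
apply/(determinesP R hN (S := S \o g)) => [s|X|]; first exact: Sp.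
  by apply/imsetP/codomP => [[k _ ->]|[k ->]]; exists k.
have -> : obs_mx R (S \o g) = rowsub g (obs_mx R S).
  by apply/matrixP => x y; rewrite !mxE.
exact: fullrowsub_full.
Qed.
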